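(* Let $\{f_i : X_i \to Y_i\}_{i\in I}$ be the trapdoor claw-free function family used in the interactive protocol described in the context. An error-free quantum device honestly following the protocol causes the verifier to return $\mathsf{Accept}$ with $p_x = 1$ and $p_{\mathrm{CHSH}} = \cos^2(\pi/8) \approx 0.85$, where $p_x$ is the probability that the verifier accepts in the case where it requests a measurement of the $\mathsf{x}$ register after the first round, and $p_{\mathrm{CHSH}}$ is the probability that the verifier accepts in the case where it continues with the second and third rounds.
   Context: Functions. $\{f_i : X_i\to Y_i\}_{i\in I}$ is a family of two-to-one functions (every element of the image of $f_i$ has exactly two preimages) with $X_i\subseteq\{0,1\}^n$. Each $f_i$ comes with trapdoor data $t$; given $t$ and any $y$ in the image of $f_i$ one can efficiently compute the two preimages $x_0\ne x_1$ of $y$. There is an efficient quantum circuit preparing $\frac{1}{\sqrt{|X_i|}}\sum_{x\in X_i}|x\rangle|f_i(x)\rangle$. For $a,b\in\{0,1\}^n$, $a\cdot b=\sum_j a_jb_j \bmod 2$. Protocol (classical verifier, prover), with the actions of the honest quantum prover. Round 1. The verifier samples $(i,t)$ and sends $i$ to the prover. The honest prover prepares $\frac{1}{\sqrt{|X_i|}}\sum_{x\in X_i}|x\rangle_{\mathsf x}|f_i(x)\rangle_{\mathsf y}$, measures the $\mathsf y$ register in the standard basis, obtaining $y$, and sends $y$ to the verifier; its state is then $\frac{1}{\sqrt2}(|x_0\rangle+|x_1\rangle)_{\mathsf x}$ with $f_i(x_0)=f_i(x_1)=y$. The verifier computes $x_0,x_1$ using $t$. The verifier now randomly chooses one of two cases.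 Case A. The verifier requests a measurement of the $\mathsf x$ register. The honest prover measures $\mathsf x$ in the standard basis and returns the result $x$. The verifier accepts iff $f_i(x)=y$. Case B. Rounds 2 and 3 are performed. Round 2. The verifier sends a uniformly random $r\in\{0,1\}^n$. Using an ancilla qubit $\mathsf b$ and CNOT gates, the honest prover computes $\frac{1}{\sqrt2}\left(|r\cdot x_0\rangle_{\mathsf b}|x_0\rangle_{\mathsf x}+|r\cdot x_1\rangle_{\mathsf b}|x_1\rangle_{\mathsf x}\right)$, measures every qubit of $\mathsf x$ in the Hadamard basis, obtaining $d\in\{0,1\}^n$, and sends $d$. Its remaining qubit $\mathsf b$ is then in the (normalized) state proportional to $(-1)^{d\cdot x_0}|r\cdot x_0\rangle+(-1)^{d\cdot x_1}|r\cdot x_1\rangle$, which up to global phase is one of $|0\rangle,|1\rangle,|+\rangle,|-\rangle$, where $|\pm\rangle=(|0\rangle\pm|1\rangle)/\sqrt2$. Round 3. The verifier sends a uniformly random $\theta\in\{\pi/4,-\pi/4\}$. The honest prover measures $\mathsf b$ in the basis with outcome $0$ corresponding to $\cos(\theta/2)|0\rangle+\sin(\theta/2)|1\rangle$ and outcome $1$ corresponding to $-\sin(\theta/2)|0\rangle+\cos(\theta/2)|1\rangle$, and sends the outcome bit. The verifier, knowing $x_0,x_1,r,d$, computes the state in $\{|0\rangle,|1\rangle,|+\rangle,|-\rangle\}$ that $\mathsf b$ should be in, and accepts iff the received bit is the more likely outcome of this measurement on that state. All probabilities are over all randomness of the verifier and of the quantum measurements. *)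

(* Defs.v *)
From HB Require Import structures.
From mathcomp Require Import all_boot all_order all_algebra.
From mathcomp Require Import all_classical all_reals all_analysis.
From mathcomp Require Import complex.

Set Implicit Arguments.
Unset Strict Implicit.
Unset Printing Implicit Defensive.

Import Order.TTheory GRing.Theory Num.Theory.
Local Open Scope ring_scope.
Local Open Scope complex_scope.

Definition bits (n : nat) := {ffun 'I_n -> bool}.

Definition dot (n : nat) (a b : bits n) : bool :=
  \big[addb/false]_(j < n) (a j && b j).

Section PureStates.
Variable R : realType.

(* Vectors of the Hilbert space with computational basis T; a register made of
   two subregisters with bases A and B has basis A * B. Vectors are not
   required to be normalized. *)
Definition state (T : finType) := {ffun T -> R[i]}.

Definition ket (T : finType) (t : T) : state T := [ffun s => (s == t)%:R].

Definition bra_ket (T : finType) (u v : state T) : R[i] :=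
  \sum_t (u t)^* * v t.

Definition sqnorm (T : finType) (u : state T) : R :=
  \sum_t Normc.normc (u t) ^+ 2.

Definition normalize (T : finType) (u : state T) : state T :=
  [ffun t => (Num.sqrt (sqnorm u))^-1%:C * u t].

(* A projective measurement is given by an orthonormal basis (e k)_k; the
   outcome k has probability `|<e k | u>|^2 on the unit vector u. *)
Definition prob (K T : finType) (e : K -> state T) (u : state T) (k : K) : R :=
  Normc.normc (bra_ket (e k) u) ^+ 2.

(* (1 (x) <e k|) u, for a measurement of the second register only. *)
Definition partial_bra (A B K : finType) (e : K -> state B) (u : state (A * B)%type)
    (k : K) : state A :=
  [ffun a => bra_ket (e k) [ffun b => u (a, b)]].

Definition prob_snd (A B K : finType) (e : K -> state B)
    (u : state (A * B)%type) (k : K) : R :=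
  sqnorm (partial_bra e u k).

(* State of the first register after outcome k. If k has probability 0 this is
   the zero vector. *)
Definition post_snd (A B K : finType) (e : K -> state B)
    (u : state (A * B)%type) (k : K) : state A :=
  normalize (partial_bra e u k).

Definition plus_minus (s : bool) : state bool :=
  [ffun q => (Num.sqrt 2)^-1%:C * (ket false q + (-1) ^+ s * ket true q)].

(* Qubit-wise Hadamard basis: the tensor product of the |+>, |-> given by d. *)
Definition hadamard_basis (n : nat) (d : bits n) : state (bits n) :=
  [ffun x : bits n => \prod_(j < n) plus_minus (d j) (x j)].

Definition rotated_basis (theta : R) (s : bool) : state bool :=
  [ffun q =>
     if s then - (sin (theta / 2))%:C * ket false q + (cos (theta / 2))%:C * ket true q
     else (cos (theta / 2))%:C * ket false q + (sin (theta / 2))%:C * ket true q].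

(* CNOT with control qubit j of the register x and target the qubit b; being an
   involution, the gate acts on amplitudes by precomposition. *)
Definition cnot (n : nat) (j : 'I_n) (u : state (bool * bits n)%type) :
    state (bool * bits n)%type :=
  [ffun bx : bool * bits n => u (bx.1 (+) bx.2 j, bx.2)].

Definition add_ancilla (n : nat) (u : state (bits n)) :
    state (bool * bits n)%type :=
  [ffun bx : bool * bits n => ket false bx.1 * u bx.2].

End PureStates.

Section HonestProver.
Variables (R : realType) (n : nat) (Y : finType).
Variables (X : {set bits n}) (f : bits n -> Y).

Definition evaluation_state : state R (bits n * Y)%type :=
  [ffun xy => (Num.sqrt #|X|%:R)^-1%:C * \sum_(x in X) ket R (x, f x) xy].

Definition prob_y (y : Y) : R := prob_snd (@ket R Y) evaluation_state y.

Definition claw_state (y : Y) : state R (bits n) :=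
  post_snd (@ket R Y) evaluation_state y.

Definition prob_x_answer (y : Y) (x : bits n) : R :=
  prob (@ket R (bits n)) (claw_state y) x.

Definition round2_state (y : Y) (r : bits n) : state R (bool * bits n)%type :=
  foldr (fun j u => if r j then cnot j u else u)
    (add_ancilla (claw_state y)) (enum 'I_n).

Definition prob_d (y : Y) (r d : bits n) : R :=
  prob_snd (@hadamard_basis R n) (round2_state y r) d.

Definition qubit_state (y : Y) (r d : bits n) : state R bool :=
  post_snd (@hadamard_basis R n) (round2_state y r) d.

Definition prob_bit (y : Y) (r d : bits n) (theta : R) (b : bool) : R :=
  prob (rotated_basis theta) (qubit_state y r d) b.

End HonestProver.

(* Labels for |0>, |1> (Comp) and |+>, |-> (Hada). *)
Inductive qubit_label := Comp of bool | Hada of bool.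

Definition label_state (R : realType) (l : qubit_label) : state R bool :=
  match l with Comp b => ket R b | Hada s => plus_minus R s end.

Definition expected_label (n : nat) (x0 x1 r d : bits n) : qubit_label :=
  if dot r x0 == dot r x1 then Comp (dot r x0)
  else Hada (dot d x0 (+) dot d x1).

(* The label is that of (-1)^(d.x0) |r.x0> + (-1)^(d.x1) |r.x1>, up to a
   scalar, unless this vector is 0 (in which case d is never observed). *)
Lemma expected_labelP (R : realType) (n : nat) (x0 x1 r d : bits n) :
  let u q : R[i] := (-1) ^+ dot d x0 * ket R (dot r x0) q +
                    (-1) ^+ dot d x1 * ket R (dot r x1) q in
  (exists q, u q != 0) ->
  exists2 c : R[i], c != 0 &
    forall q, u q = c * label_state R (expected_label x0 x1 r d) q.
Proof.
have s2 : (Num.sqrt 2)%:C != 0 :> R[i].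
  by rewrite fmorph_eq0 sqrtr_eq0 -ltNge ltr0n.
have s2V x : (Num.sqrt 2)%:C * ((Num.sqrt 2)^-1%:C * x) = x :> R[i].
  by rewrite mulrA fmorphV mulfV // mul1r.
move=> u; rewrite /u {u} /expected_label.
case: eqP => [->|].
  case=> q0; rewrite -mulrDl => u0.
  exists ((-1) ^+ dot d x0 + (-1) ^+ dot d x1); last by move=> q; rewrite mulrDl.
  by apply: contraNneq u0 => ->; rewrite mul0r.
move: (dot r x0) (dot r x1) (dot d x0) (dot d x1) => a b s t ab _.
exists ((-1) ^+ (if a then t else s) * (Num.sqrt 2)%:C).
  by rewrite mulf_neq0 ?signr_eq0.
move=> q; rewrite [label_state _ _ _]ffunE -mulrA s2V mulrDr mulrA -signr_addb.
by case: a b ab s t => -[] // _ [] []; rewrite /= // addrC.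
Qed.

Section Verifier.
Variables (R : realType) (n : nat) (Y : finType).
Variables (X : {set bits n}) (f : bits n -> Y).

Definition accepts_x (y : Y) (x : bits n) : bool := (x \in X) && (f x == y).

(* The bit b is strictly more likely than the other outcome. *)
Definition accepts_bit (x0 x1 r d : bits n) (theta : R) (b : bool) : bool :=
  let v := label_state R (expected_label x0 x1 r d) in
  prob (rotated_basis theta) v (~~ b) < prob (rotated_basis theta) v b.

(* Acceptance probabilities for a fixed function. *)
Definition accept_caseA : R :=
  \sum_y prob_y R X f y *
    \sum_x prob_x_answer R X f y x * (accepts_x y x)%:R.

(* preimages is the verifier's trapdoor computation of (x0, x1) from y. *)
Definition accept_caseB (preimages : Y -> bits n * bits n) : R :=
  \sum_y prob_y R X f y *
    \sum_(r : bits n) #|{: bits n}|%:R^-1 *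
      \sum_d prob_d R X f y r d *
        \sum_(sgn : bool) 2^-1 *
          let theta := (-1) ^+ sgn * (pi / 4) in
          \sum_(b : bool) prob_bit X f y r d theta b *
            (accepts_bit (preimages y).1 (preimages y).2 r d theta b)%:R.

End Verifier.

Section Family.
Variables (R : realType) (n : nat).

(* Only the values of f on X are relevant. *)
Definition two_to_one (Y : finType) (X : {set bits n}) (f : bits n -> Y) :=
  forall y, y \in f @: X -> #|[set x in X | f x == y]| = 2%N.

Definition computes_preimages (Y : finType) (X : {set bits n})
    (f : bits n -> Y) (preimages : Y -> bits n * bits n) :=
  forall y, y \in f @: X ->
    (preimages y).1 != (preimages y).2 /\
    [set x in X | f x == y] = [set (preimages y).1; (preimages y).2].

Definition is_distribution (K : choiceType) (p : K -> R) :=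
  (forall k, 0 <= p k) /\ (\esum_(k in [set: K]) (p k)%:E = 1)%E.

Variables (I T : choiceType) (X : I -> {set bits n}) (Y : I -> finType).
Variable f : forall i, bits n -> Y i.

Definition p_x (gen : I * T -> R) : \bar R :=
  (\esum_(k in [set: I * T]) (gen k * accept_caseA R (X k.1) (@f k.1))%:E)%E.

Definition p_CHSH (invert : forall i, T -> Y i -> bits n * bits n)
    (gen : I * T -> R) : \bar R :=
  (\esum_(k in [set: I * T])
     (gen k * accept_caseB R (X k.1) (@f k.1) (@invert k.1 k.2))%:E)%E.

End Family.

(* Main.v *)
(* After round 1 the prover holds a unit vector supported, with equal
   amplitudes, on the preimages of y, so that a standard basis measurement is
   always accepted. In case B, the residual qubit after outcome d is, up to a
   scalar, (-1)^(d.x0) |r.x0> + (-1)^(d.x1) |r.x1>, hence a phase times the state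
   expected by the verifier; all four possible states and both angles give
   outcome probabilities cos^2(pi/8) and sin^2(pi/8), so conditioning on y, r
   and d is harmless. The probabilities of y and of d sum to 1 by Parseval's
   identity for the bases measured. *)

Require Import Defs.
From mathcomp Require Import all_boot all_order all_algebra.
From mathcomp Require Import all_classical all_reals all_analysis.
From mathcomp Require Import complex ring lra.

Set Implicit Arguments.
Unset Strict Implicit.
Unset Printing Implicit Defensive.

Import Order.TTheory GRing.Theory Num.Theory.
Local Open Scope ring_scope.
Local Open Scope complex_scope.

(** * Norms, outcome probabilities and Parseval's identity *)

Section Measurement.
Variable R : realType.
Implicit Types A B K T : finType.

Lemma conjC_real_complex (x : R) : (x%:C)^*%R = x%:C :> R[i].
Proof. exact: conjc_real. Qed.

Lemma normc_real (x : R) : Normc.normc x%:C = `|x|.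
Proof. by rewrite /Normc.normc /= expr0n addr0 sqrtr_sqr. Qed.

Lemma sqr_normc_complex (z : R[i]) : (Normc.normc z ^+ 2)%:C = z * z^*.
Proof. by rewrite -normCK rmorphXn. Qed.

Lemma sqr_normcM (z w : R[i]) :
  Normc.normc (z * w) ^+ 2 = Normc.normc z ^+ 2 * Normc.normc w ^+ 2.
Proof. by rewrite Normc.normcM exprMn. Qed.

Lemma sqr_normc_bool (b : bool) : Normc.normc (b%:R : R[i]) ^+ 2 = b%:R.
Proof. by case: b; rewrite ?Normc.normc1 ?Normc.normc0 ?expr1n ?expr0n. Qed.

Lemma sqr_normc_sign (k : nat) : Normc.normc ((-1) ^+ k : R[i]) ^+ 2 = 1.
Proof.
by rewrite -(rmorph_sign (@real_complex R)) normc_real normrX normrN1 !expr1n.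
Qed.

Lemma sqnormZ T (c : R[i]) (u v : state R T) :
  u =1 (fun t => c * v t) -> sqnorm u = Normc.normc c ^+ 2 * sqnorm v.
Proof.
by move=> uE; rewrite mulr_sumr; apply: eq_bigr => t _; rewrite uE sqr_normcM.
Qed.

Lemma sqnorm_ge0 T (u : state R T) : 0 <= sqnorm u.
Proof. by apply: sumr_ge0 => t _; apply: sqr_ge0. Qed.

Lemma sqnorm_neq0 T (u : state R T) : sqnorm u != 0 -> exists t, u t != 0.
Proof.
move=> u0; apply/existsP; apply: contraNT u0 => /existsPn u0.
rewrite /sqnorm big1 // => t _; move/negPn/eqP: (u0 t) => ->.
by rewrite Normc.normc0 expr0n.
Qed.

Lemma sqr_normalization (x : R) : 0 <= x ->
  Normc.normc (Num.sqrt x)^-1%:C ^+ 2 = x^-1.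
Proof.
by move=> x0; rewrite normc_real real_normK ?num_real// exprVn sqr_sqrtr.
Qed.

Lemma sqnorm_normalize T (u : state R T) :
  sqnorm u != 0 -> sqnorm (normalize u) = 1.
Proof.
move=> u0; rewrite (sqnormZ (fun t => ffunE _ t)).
by rewrite sqr_normalization ?sqnorm_ge0 // mulVf.
Qed.

Lemma bra_ketZ T (c : R[i]) (e u v : state R T) :
  u =1 (fun t => c * v t) -> bra_ket e u = c * bra_ket e v.
Proof.
by move=> uE; rewrite mulr_sumr; apply: eq_bigr => t _; rewrite uE mulrCA.
Qed.

(** Normalizing leaves only the phase of [c], which no measurement detects; equality up to a scalar
    thus becomes equality of probabilities. *)
Lemma prob_normalizeZ T K (e : K -> state R T) (c : R[i]) (u v : state R T) k :
  c != 0 -> sqnorm v = 1 -> u =1 (fun t => c * v t) ->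
  prob e (normalize u) k = prob e v k.
Proof.
move=> c0 v1 uE.
have uE' t : normalize u t = ((Num.sqrt (sqnorm u))^-1%:C * c) * v t.
  by rewrite ffunE uE mulrA.
rewrite /prob (bra_ketZ _ uE') sqr_normcM sqr_normcM.
rewrite sqr_normalization ?sqnorm_ge0// (sqnormZ uE) v1 mulr1 mulVf ?mul1r//.
by rewrite sqrf_eq0; apply: contraNneq c0 => /Normc.eq0_normc ->.
Qed.

Lemma bra_ket_ket T (t : T) (u : state R T) : bra_ket (ket R t) u = u t.
Proof.
rewrite /bra_ket (bigD1 t) //= ffunE eqxx conjC1 mul1r big1 ?addr0 // => s st.
by rewrite ffunE (negPf st) conjC0 mul0r.
Qed.

Lemma sum_prob_ket T (u : state R T) : \sum_t prob (@ket R T) u t = sqnorm u.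
Proof. by apply: eq_bigr => t _; rewrite /prob bra_ket_ket. Qed.

(* Completeness relation sum_k |e_k><e_k| = 1, written in coordinates; it is
   all that Parseval's identity needs. *)
Definition complete K T (e : K -> state R T) :=
  forall s t, \sum_k (e k s)^* * e k t = (s == t)%:R.

Lemma complete_ket T : complete (@ket R T).
Proof.
move=> s t; rewrite (bigD1 s) //= big1 => [|k ks].
  by rewrite !ffunE eqxx conjC1 mul1r addr0 eq_sym.
by rewrite ffunE eq_sym (negPf ks) conjC0 mul0r.
Qed.

(** Expanding the square gives a double sum over [s] and [t]; summing over [k] first, completeness
    kills the terms with [s != t]. *)
Lemma sum_sqr_bra_ket K T (e : K -> state R T) (u : state R T) :
  complete e -> \sum_k Normc.normc (bra_ket (e k) u) ^+ 2 = sqnorm u.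
Proof.
move=> ce; apply: (fmorph_inj (@real_complex R)); rewrite !rmorph_sum /=.
transitivity (\sum_k \sum_s \sum_t ((e k s)^* * e k t) * (u s * (u t)^*)).
  apply: eq_bigr => k _; rewrite sqr_normc_complex rmorph_sum mulr_suml.
  apply: eq_bigr => s _; rewrite mulr_sumr; apply: eq_bigr => t _.
  by rewrite rmorphM /= conjCK mulrACA.
rewrite exchange_big; apply: eq_bigr => s _; rewrite exchange_big /=.
rewrite (bigD1 s) //= [X in _ + X]big1 => [|t ts].
  by rewrite addr0 -mulr_suml ce eqxx mul1r sqr_normc_complex.
by rewrite -mulr_suml ce eq_sym (negPf ts) mul0r.
Qed.

(** Parseval in the second register, applied separately for each basis label [a] of the first. *)
Lemma sum_prob_snd A B K (e : K -> state R B) (u : state R (A * B)%type) :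
  complete e -> \sum_k prob_snd e u k = sqnorm u.
Proof.
move=> ce; rewrite exchange_big /=.
transitivity (\sum_a \sum_b Normc.normc (u (a, b)) ^+ 2); last first.
  by rewrite pair_bigA; apply: eq_bigr => -[].
apply: eq_bigr => a _.
under eq_bigr => k _ do rewrite ffunE.
rewrite sum_sqr_bra_ket //.
by apply: eq_bigr => b _; rewrite ffunE.
Qed.

End Measurement.

(** * The Hadamard basis and the chain of CNOT gates *)

Section Hadamard.
Variables (R : realType) (n : nat).

Lemma sqrt2V_sqr : (Num.sqrt 2)^-1%:C * (Num.sqrt 2)^-1%:C = 2^-1 :> R[i].
Proof. by rewrite -rmorphM -expr2 exprVn sqr_sqrtr // fmorphV rmorph_nat. Qed.

Lemma plus_minusE (s q : bool) :
  plus_minus R s q = (Num.sqrt 2)^-1%:C * (-1) ^+ (s && q).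
Proof.
rewrite !ffunE; case: q s => -[] /=.
all: by rewrite ?expr0 ?expr1 ?mulr0 ?addr0 ?add0r !mulr1.
Qed.

Lemma conj_plus_minus (s q : bool) : (plus_minus R s q)^*%R = plus_minus R s q.
Proof.
rewrite plus_minusE -[(-1) ^+ _](rmorph_sign (@real_complex R)) -rmorphM.
exact: conjC_real_complex.
Qed.

Lemma complete_plus_minus : complete (plus_minus R).
Proof.
move=> q q'; rewrite big_bool /= !conj_plus_minus !plus_minusE !andTb !andFb.
rewrite expr0 mulr1.
(* The signs for [q] and [q'] multiply to that of [q (+) q'], so the two terms cancel exactly when
   [q] and [q'] differ. *)
transitivity (2^-1 * ((-1) ^+ (q (+) q') + 1) : R[i]).
  by rewrite -sqrt2V_sqr signr_addb; ring.
case: q q' => -[]; rewrite /= ?expr0 ?expr1 ?addNr ?mulr0 //.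
all: by rewrite mulVf ?pnatr_eq0.
Qed.

Lemma hadamard_basisE (d x : bits n) :
  hadamard_basis R d x = (Num.sqrt 2)^-1%:C ^+ n * (-1) ^+ dot d x.
Proof.
rewrite ffunE /dot; under eq_bigr => j _ do rewrite plus_minusE.
rewrite big_split /= prodr_const card_ord; congr (_ * _).
apply: (big_ind2 (fun (z : R[i]) (b : bool) => z = (-1) ^+ b)) => //.
by move=> z b z' b' -> ->; rewrite signr_addb.
Qed.

Lemma conj_hadamard_basis (d x : bits n) :
  (hadamard_basis R d x)^*%R = hadamard_basis R d x.
Proof.
by rewrite ffunE rmorph_prod; apply: eq_bigr => j _; apply: conj_plus_minus.
Qed.

(** Completeness passes to tensor products: the product of the single-qubit relations expands into a
    sum over all choices [d] of signs. *)
Lemma complete_hadamard : complete (@hadamard_basis R n).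
Proof.
move=> x y.
transitivity (\prod_(j < n) (x j == y j)%:R : R[i]).
  under [RHS]eq_bigr => j _ do rewrite -complete_plus_minus.
  rewrite bigA_distr_bigA; apply: eq_bigr => d _.
  by rewrite !ffunE rmorph_prod -big_split.
have [->|xy] := eqVneq x y; first by rewrite big1 // => j _; rewrite eqxx.
have /existsP [j xyj] : [exists j, x j != y j].
  by apply: contraNT xy => /existsPn xy; apply/eqP/ffunP => j; apply/eqP/negPn.
by rewrite (bigD1 j) //= (negPf xyj) mul0r.
Qed.

(** Stated for any list of qubits and any [b] so that induction applies: the gates fix [x], and each
    XORs one control bit into [b]. *)
Lemma foldr_cnotE (r : bits n) (s : seq 'I_n) (u : state R (bool * bits n)%type)
    (b : bool) (x : bits n) :
  foldr (fun j u => if r j then cnot j u else u) u s (b, x) =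
  u (b (+) \big[addb/false]_(j <- s) (r j && x j), x).
Proof.
elim: s b => [|j s IHs] b /=; first by rewrite big_nil addbF.
by rewrite big_cons; case: (r j); rewrite ?ffunE IHs //= addbA.
Qed.

End Hadamard.

(** * The honest states for a fixed function, and case A *)

Section FixedFunction.
Variables (R : realType) (n : nat) (Y : finType).
Variables (X : {set bits n}) (f : bits n -> Y).

Lemma round2_stateE (y : Y) (r : bits n) (b : bool) (x : bits n) :
  round2_state R X f y r (b, x) = (b == dot r x)%:R * claw_state R X f y x.
Proof.
rewrite /round2_state foldr_cnotE ffunE big_enum ffunE; congr (_%:R * _).
by rewrite -/(dot r x); case: b (dot r x) => -[].
Qed.

(** For each [x] a single value of [b], namely [dot r x], carries the amplitude. *)
Lemma sqnorm_round2 (y : Y) (r : bits n) :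
  sqnorm (round2_state R X f y r) = sqnorm (claw_state R X f y).
Proof.
rewrite /sqnorm.
transitivity (\sum_b \sum_x Normc.normc (round2_state R X f y r (b, x)) ^+ 2).
  by rewrite pair_bigA; apply: eq_bigr => -[].
rewrite exchange_big; apply: eq_bigr => x _; rewrite big_bool !round2_stateE.
by case: (dot r x); rewrite /= mul1r mul0r Normc.normc0 expr0n ?addr0 ?add0r.
Qed.

Lemma evaluation_stateE (x : bits n) (y : Y) :
  evaluation_state R X f (x, y) =
  (Num.sqrt #|X|%:R)^-1%:C * ((x \in X) && (f x == y))%:R.
Proof.
rewrite ffunE; congr (_ * _); have [xX|xX] := boolP (x \in X).
  rewrite (bigD1 x) //= ffunE xpair_eqE eqxx eq_sym /= big1 ?addr0 //.
  by move=> z /andP[_ zx]; rewrite ffunE xpair_eqE eq_sym (negPf zx).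
rewrite big1 // => z zX; rewrite ffunE xpair_eqE.
by have [xz|//] := eqVneq x z; rewrite xz zX in xX.
Qed.

Lemma sqnorm_evaluation_state :
  (0 < #|X|)%N -> sqnorm (evaluation_state R X f) = 1.
Proof.
move=> X0; rewrite /sqnorm.
transitivity (\sum_x \sum_y (#|X|%:R^-1 * ((x \in X) && (f x == y))%:R : R)).
  rewrite pair_bigA; apply: eq_bigr => -[x y] _.
  rewrite evaluation_stateE sqr_normcM sqr_normalization //.
  by rewrite sqr_normc_bool.
rewrite (bigID (mem X)) /= [X in _ + X]big1 ?addr0; last first.
  by move=> x /negPf ->; rewrite big1 // => y _; rewrite mulr0.
rewrite (eq_bigr (fun=> #|X|%:R^-1)) => [|x ->].
  by rewrite sumr_const -[LHS]mulr_natr mulVf // pnatr_eq0 -lt0n.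
rewrite (bigD1 (f x)) //= eqxx mulr1 big1 ?addr0 // => y.
by rewrite eq_sym => /negPf ->; rewrite mulr0.
Qed.

Lemma sum_prob_y : (0 < #|X|)%N -> \sum_y prob_y R X f y = 1.
Proof.
by move=> X0; rewrite (sum_prob_snd _ (@complete_ket R Y)) sqnorm_evaluation_state.
Qed.

(** [c] collects the two normalizing factors; only its independence of [x] matters below. *)
Lemma claw_stateE (y : Y) : exists c : R[i], forall x,
  claw_state R X f y x = c * ((x \in X) && (f x == y))%:R.
Proof.
eexists => x; rewrite ffunE ffunE bra_ket_ket ffunE evaluation_stateE.
by rewrite mulrA.
Qed.

(** Makes [computes_preimages] applicable to every [y] that the prover can send. *)
Lemma prob_y_image (y : Y) : prob_y R X f y != 0 -> y \in f @: X.
Proof.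
case/sqnorm_neq0 => x; rewrite ffunE bra_ket_ket ffunE evaluation_stateE.
case: andP => [[xX /eqP <-] _|]; first exact: imset_f.
by rewrite mulr0 eqxx.
Qed.

Lemma sqnorm_claw_state (y : Y) :
  prob_y R X f y != 0 -> sqnorm (claw_state R X f y) = 1.
Proof. exact: sqnorm_normalize. Qed.

Lemma accept_caseA_eq1 : (0 < #|X|)%N -> accept_caseA R X f = 1.
Proof.
move=> X0; rewrite -(sum_prob_y X0); apply: eq_bigr => y _.
(* A [y] of probability 0 is set apart: its [claw_state] is the zero vector, not a unit vector. *)
have [->|y0] := eqVneq (prob_y R X f y) 0; first by rewrite mul0r.
rewrite -[RHS]mulr1 -[X in _ = _ * X](sqnorm_claw_state y0) -sum_prob_ket; congr (_ * _).
apply: eq_bigr => x _; rewrite /prob_x_answer /prob bra_ket_ket /accepts_x.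
have [c ->] := claw_stateE y.
by case: (_ && _); rewrite ?mulr1 // !mulr0 Normc.normc0 expr0n.
Qed.

End FixedFunction.

(** * Trigonometry at [pi / 8] and the likelier outcome *)

Section LikelyOutcome.
Variable R : realType.

Lemma cos_piquarter : cos (pi / 4) = (Num.sqrt 2)^-1 :> R.
Proof.
have c0 : 0 < cos (pi / 4 : R).
  by apply: cos_gt0_pihalf; have := pi_gt0 R; lra.
have : cos (pi / 4 *+ 2) = 0 :> R.
  by rewrite -[RHS]cos_pihalf; congr cos; rewrite mulr2n; field.
rewrite cos_mulr2n => cE.
rewrite -sqrtrV ?ler0n // -(ger0_norm (ltW c0)) -sqrtr_sqr; congr Num.sqrt.
by move: cE; rewrite mulr2n; lra.
Qed.

Lemma sin_piquarter : sin (pi / 4) = (Num.sqrt 2)^-1 :> R.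
Proof.
have c0 : cos (pi / 4 : R) != 0.
  by rewrite cos_piquarter invr_eq0 sqrtr_eq0 -ltNge ltr0n.
rewrite -cos_piquarter -[LHS](mulfVK c0) -/(tan _) tan_piquarter.
by rewrite mul1r.
Qed.

Lemma sqr_sqrt2V : (Num.sqrt 2)^-1 ^+ 2 = 2^-1 :> R.
Proof. by rewrite exprVn sqr_sqrtr. Qed.

Lemma sqr_cos_pi8 : cos (pi / 8) ^+ 2 = (1 + (Num.sqrt 2)^-1) / 2 :> R.
Proof.
have : cos (pi / 8 *+ 2) = (Num.sqrt 2)^-1 :> R.
  by rewrite -cos_piquarter; congr cos; rewrite mulr2n; field.
by rewrite cos_mulr2n mulr2n; lra.
Qed.

Lemma sqr_sin_pi8 : sin (pi / 8) ^+ 2 = (1 - (Num.sqrt 2)^-1) / 2 :> R.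
Proof. by have := cos2Dsin2 (pi / 8 : R); rewrite sqr_cos_pi8; lra. Qed.

Lemma cosMsin_pi8 : cos (pi / 8) * sin (pi / 8) = (Num.sqrt 2)^-1 / 2 :> R.
Proof.
have : sin (pi / 8 *+ 2) = (Num.sqrt 2)^-1 :> R.
  by rewrite -sin_piquarter; congr sin; rewrite mulr2n; field.
by rewrite sin_mulr2n mulr2n; lra.
Qed.

Lemma prob_real (K T : finType) (e : K -> state R T) (u : state R T) (k : K)
    (a b : T -> R) :
  (forall t, e k t = (a t)%:C) -> (forall t, u t = (b t)%:C) ->
  prob e u k = (\sum_t a t * b t) ^+ 2.
Proof.
move=> eE uE; rewrite /prob /bra_ket.
under eq_bigr => t _ do rewrite eE uE conjC_real_complex -rmorphM.
by rewrite -rmorph_sum normc_real real_normK ?num_real.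
Qed.

Lemma rotated_basisE (theta : R) (s q : bool) :
  rotated_basis theta s q =
  (if s then if q then cos (theta / 2) else - sin (theta / 2)
   else if q then sin (theta / 2) else cos (theta / 2))%:C.
Proof.
by case: s q => -[]; rewrite !ffunE /= ?mulr1 ?mulr0 ?addr0 ?add0r ?rmorphN.
Qed.

Lemma prob_rotated (theta : R) (u : state R bool) (v : bool -> R) (b : bool) :
  (forall q, u q = (v q)%:C) ->
  prob (rotated_basis theta) u b =
  (if b then cos (theta / 2) * v true - sin (theta / 2) * v false
   else sin (theta / 2) * v true + cos (theta / 2) * v false) ^+ 2.
Proof.
move=> uE; rewrite (prob_real (rotated_basisE theta b) uE) big_bool.
by case: b => /=; rewrite ?mulNr.
Qed.

Lemma sqnorm_label_state (l : qubit_label) : sqnorm (label_state R l) = 1.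
Proof.
rewrite /sqnorm big_bool /=; case: l => [b|s] /=.
  by rewrite !ffunE !sqr_normc_bool; case: b; rewrite ?addr0 ?add0r.
rewrite !plus_minusE !sqr_normcM sqr_normalization //.
by rewrite !sqr_normc_sign; field.
Qed.

(** All vectors are real: the expected states lie on lines at multiples of [pi / 4] and the basis is
    turned by [pi / 8] either way, so each state makes an angle [pi / 8] with one basis line. *)
Lemma likely_outcome (l : qubit_label) (sgn : bool) :
  let theta : R := (-1) ^+ sgn * (pi / 4) in
  exists b,
    prob (rotated_basis theta) (label_state R l) b = cos (pi / 8) ^+ 2 /\
    prob (rotated_basis theta) (label_state R l) (~~ b) = sin (pi / 8) ^+ 2.
Proof.
have thetaE : (-1) ^+ sgn * (pi / 4) / 2 = (-1) ^+ sgn * (pi / 8) :> R by field.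
have cosE : cos ((-1) ^+ sgn * (pi / 4) / 2) = cos (pi / 8) :> R.
  by rewrite thetaE; case: sgn {thetaE}; rewrite ?mul1r // mulN1r cosN.
have sinE : sin ((-1) ^+ sgn * (pi / 4) / 2) = (-1) ^+ sgn * sin (pi / 8) :> R.
  by rewrite thetaE; case: sgn {thetaE cosE}; rewrite ?mul1r // !mulN1r sinN.
move=> theta; rewrite /theta {theta}.
case: l => [b|s].
  have uE q : label_state R (Comp b) q = ((q == b)%:R : R)%:C.
    by rewrite ffunE rmorph_nat.
  exists b; rewrite !(prob_rotated _ _ uE) cosE sinE.
  clear thetaE cosE sinE uE.
  by case: b sgn => -[]; split=> /=; ring.
have uE q : label_state R (Hada s) q = ((Num.sqrt 2)^-1 * (-1) ^+ (s && q))%:C.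
  by rewrite [LHS]plus_minusE rmorphM rmorph_sign.
(* For the state |+> and the positive angle the likelier outcome is 0; flipping the sign of the
   state or of the angle swaps the outcomes. *)
exists (s (+) sgn); rewrite !(prob_rotated _ _ uE) cosE sinE.
(* The left sides of [plus] and [minus] are the squares of [cos (pi / 4 - pi / 8)] and
   [cos (pi / 4 + pi / 8)]. *)
have plus : ((Num.sqrt 2)^-1 * (cos (pi / 8) + sin (pi / 8))) ^+ 2 =
            cos (pi / 8) ^+ 2 :> R.
  rewrite exprMn sqr_sqrt2V sqrrD sqr_sin_pi8 cosMsin_pi8 sqr_cos_pi8 mulr2n.
  by field.
have minus : ((Num.sqrt 2)^-1 * (cos (pi / 8) - sin (pi / 8))) ^+ 2 =
             sin (pi / 8) ^+ 2 :> R.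
  rewrite exprMn sqr_sqrt2V sqrrB sqr_cos_pi8 cosMsin_pi8 sqr_sin_pi8 mulr2n.
  by field.
rewrite -plus -minus; clear thetaE cosE sinE uE plus minus.
by case: s sgn => -[]; split=> /=; ring.
Qed.

End LikelyOutcome.

(** * The residual qubit and acceptance in case B *)

Section CaseB.
Variables (R : realType) (n : nat) (Y : finType).
Variables (X : {set bits n}) (f : bits n -> Y).

Lemma partial_bra_round2 (y : Y) (r d x0 x1 : bits n) :
  x0 != x1 -> [set x in X | f x == y] = [set x0; x1] ->
  exists c : R[i], forall q,
    partial_bra (@hadamard_basis R n) (round2_state R X f y r) d q =
    c * ((-1) ^+ dot d x0 * ket R (dot r x0) q +
         (-1) ^+ dot d x1 * ket R (dot r x1) q).
Proof.
move=> x01 /setP preim; have [c clawE] := claw_stateE R X f y.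
have preimE x : (x \in X) && (f x == y) = (x == x0) || (x == x1).
  by have := preim x; rewrite !inE.
(* The power of [(Num.sqrt 2)^-1] comes from the Hadamard basis vector, [c] from the claw state. *)
exists ((Num.sqrt 2)^-1%:C ^+ n * c) => q; rewrite ffunE /bra_ket.
under eq_bigr => x _.
  rewrite conj_hadamard_basis hadamard_basisE ffunE round2_stateE clawE preimE.
  over.
have x10 : x1 != x0 by rewrite eq_sym.
rewrite (bigD1 x0) //= (bigD1 x1) //= big1 => [|x /andP[xx0 xx1]].
  by rewrite !ffunE !eqxx orbT /=; ring.
by rewrite (negPf xx0) (negPf xx1) !mulr0.
Qed.

(** A nonzero probability of [d] makes the residual vector nonzero, so [expected_labelP] applies and
    both scalars are nonzero. *)
Lemma prob_bitE (y : Y) (r d x0 x1 : bits n) (theta : R) (b : bool) :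
  x0 != x1 -> [set x in X | f x == y] = [set x0; x1] ->
  prob_d R X f y r d != 0 ->
  prob_bit X f y r d theta b =
  prob (rotated_basis theta) (label_state R (expected_label x0 x1 r d)) b.
Proof.
move=> x01 preim d0; have [c bE] := partial_bra_round2 r d x01 preim.
have [q] := sqnorm_neq0 d0; rewrite bE mulf_eq0 negb_or => /andP[c0 uq].
have [c' c'0 uE] := expected_labelP (ex_intro _ q uq).
apply: (prob_normalizeZ _ _ (mulf_neq0 c0 c'0)); first exact: sqnorm_label_state.
by move=> p; rewrite bE uE mulrA.
Qed.

Lemma accept_bit_eq (y : Y) (r d x0 x1 : bits n) (sgn : bool) :
  x0 != x1 -> [set x in X | f x == y] = [set x0; x1] ->
  prob_d R X f y r d != 0 ->
  let theta : R := (-1) ^+ sgn * (pi / 4) in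
  \sum_(b : bool) prob_bit X f y r d theta b *
    (accepts_bit x0 x1 r d theta b)%:R = cos (pi / 8) ^+ 2.
Proof.
move=> x01 preim d0 theta.
have [b [pb pNb]] := likely_outcome R (expected_label x0 x1 r d) sgn.
(* With this strict inequality [accepts_bit] accepts [b] and rejects [~~ b]. *)
have lt_sc : sin (pi / 8) ^+ 2 < cos (pi / 8) ^+ 2 :> R.
  rewrite sqr_sin_pi8 sqr_cos_pi8 ltr_pM2r ?invr_gt0 ?ltr0n // ltrD2l.
  by rewrite gtrN // invr_gt0 sqrtr_gt0 ltr0n.
rewrite (bigD1 b) //= (bigD1 (~~ b)) /=; last by case: (b).
rewrite big1 ?addr0 => [|b']; last by case: b b' {pb pNb} => -[].
rewrite !(prob_bitE _ _ x01 preim d0) /accepts_bit negbK pb pNb lt_sc.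
by rewrite (lt_gtF lt_sc) mulr1 mulr0 addr0.
Qed.

Lemma accept_caseB_eq (preimages : Y -> bits n * bits n) :
  (0 < #|X|)%N -> computes_preimages X f preimages ->
  accept_caseB R X f preimages = cos (pi / 8) ^+ 2.
Proof.
move=> X0 inv; rewrite -[RHS]mul1r -[X in _ = X * _](sum_prob_y R f X0) mulr_suml.
apply: eq_bigr => y _.
have [->|y0] := eqVneq (prob_y R X f y) 0; first by rewrite !mul0r.
have [x01 preim] := inv y (prob_y_image y0); congr (_ * _).
rewrite (eq_bigr (fun=> #|{: bits n}|%:R^-1 * cos (pi / 8) ^+ 2)) => [|r _].
  rewrite sumr_const -[LHS]mulr_natl mulrA mulfV ?mul1r // pnatr_eq0 -lt0n.
  by apply/card_gt0P; exists [ffun=> false].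
(* The factor 1 becomes the total probability of [d]: the round 2 state has the norm of the claw
   state, which is 1. *)
congr (_ * _); rewrite -[RHS]mul1r -[X in _ = X * _](sqnorm_claw_state y0).
rewrite -(sqnorm_round2 _ _ _ _ r) -(sum_prob_snd _ (@complete_hadamard R n)) mulr_suml.
apply: eq_bigr => d _.
have [d0|d0] := eqVneq (prob_d R X f y r d) 0.
  by rewrite [prob_snd _ _ _]d0 d0 !mul0r.
congr (_ * _); rewrite (eq_bigr (fun=> 2^-1 * cos (pi / 8) ^+ 2)) => [|sgn _].
  by rewrite big_bool /=; field.
by congr (_ * _); apply: accept_bit_eq.
Qed.

End CaseB.

(** * Averaging over the sampled keys *)

Lemma ge0_esumZl (R : realType) (K : choiceType) (c : R) (a : K -> \bar R) :
  0 <= c -> (forall k, 0 <= a k)%E ->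
  (\esum_(k in [set: K]) (c%:E * a k) = c%:E * \esum_(k in [set: K]) a k)%E.
Proof.
move=> c0 a0; rewrite /esum -ereal_supZl //; last first.
  (* The supremum is over a nonempty set: the empty index set gives the sum 0. *)
  apply/set0P; exists 0%E, classical_sets.set0; first exact: fsets_set0.
  by rewrite fsbig_set0.
rewrite image_comp; congr ereal_sup; apply: eq_imagel => A _ /=.
by rewrite ge0_mule_fsumr.
Qed.

(** [a] is constrained only on the support of [p], because inversion is assumed correct only for
    keys of positive probability. *)
Lemma esum_distribution_cst (R : realType) (K : choiceType) (p a : K -> R) (c : R) :
  is_distribution p -> (forall k, 0 < p k -> a k = c) -> 0 <= c ->
  (\esum_(k in [set: K]) (p k * a k)%:E = c%:E)%E.
Proof.
move=> [p0 p1] aE c0.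
rewrite (eq_esum (b := fun k => (c%:E * (p k)%:E)%E)) => [|k _].
  by rewrite ge0_esumZl ?p1 ?mule1 // => k; rewrite lee_fin.
have [pk|pk] := eqVneq (p k) 0; first by rewrite pk mul0r mule0.
by rewrite aE ?lt0r ?pk ?p0 // mulrC EFinM.
Qed.

Theorem theorem1 (R : realType) (n : nat) (I T : choiceType)
    (X : I -> {set bits n}) (Y : I -> finType) (f : forall i, bits n -> Y i)
    (invert : forall i, T -> Y i -> bits n * bits n) (gen : I * T -> R)
    (X_nonempty : forall i, (0 < #|X i|)%N)
    (f_two_to_one : forall i, two_to_one (X i) (f i))
    (gen_distribution : is_distribution gen)
    (trapdoor : forall i t, 0 < gen (i, t) ->
       computes_preimages (X i) (f i) (invert i t)) :
  p_x X f gen = 1%:E /\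
  p_CHSH X f invert gen = (cos (pi / 8) ^+ 2)%:E /\
  `|cos (pi / 8) ^+ 2 - 85 / 100 : R| < 5 / 1000.
Proof.
split; [|split].
- by apply: esum_distribution_cst => // k _; apply: accept_caseA_eq1.
- apply: esum_distribution_cst => // [[i t] it|]; last exact: sqr_ge0.
  exact: accept_caseB_eq (trapdoor i t it).
- have h0 : 0 < (Num.sqrt 2)^-1 :> R by rewrite invr_gt0 sqrtr_gt0 ltr0n.
  have h2 := sqr_sqrt2V R.
  rewrite sqr_cos_pi8 ltr_norml; move: h0 h2; set h := (Num.sqrt 2)^-1 => h0 h2.
  (* [0.69^2 < 1/2 < 0.71^2]; these bounds put [(1 + h) / 2] strictly between 0.845 and 0.855. *)
  have lo : 69 / 100 < h by nra.
  have hi : h < 71 / 100 by nra.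
  by apply/andP; split; lra.
Qed.
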